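(* Let $f,g_1,\dots,g_m,h_1,\dots,h_l\in\mathbb{R}[\mathbf{x}]$ and consider the POP of minimizing $f$ over $S(g)\cap V(h)$. If $R-\|\mathbf{x}\|_2^2\in\{g_1,\dots,g_m\}$ for some $R>0$, then $(0,\infty)\subseteq Q_k^\circ(g)$ for every integer $k\ge k_{\min}$, and therefore the POP has the constant trace property (CTP).
   Context: $\mathbf{x}=(x_1,\dots,x_n)$; for $p\in\mathbb{R}[\mathbf{x}]$, $\lceil p\rceil:=\lceil\deg(p)/2\rceil$. $\mathbb{N}^n_d:=\{\alpha\in\mathbb{N}^n:|\alpha|\le d\}$, $s(d):=\binom{n+d}{n}$, $\mathbf{v}_d=(\mathbf{x}^\alpha)_{\alpha\in\mathbb{N}^n_d}$. $g=\{g_i\}_{i\in[m]}$, $h=\{h_j\}_{j\in[l]}$, $S(g):=\{\mathbf{x}:g_i(\mathbf{x})\ge0\ \forall i\}$, $V(h):=\{\mathbf{x}:h_j(\mathbf{x})=0\ \forall j\}$, $k_{\min}:=\max\{\lceil f\rceil,\lceil g_i\rceil,\lceil h_j\rceil\}$. $Q_k^\circ(g):=\{\mathbf{v}_k^\top\mathbf{G}_0\mathbf{v}_k+\sum_{i\in[m]}g_i\mathbf{v}_{k-\lceil g_i\rceil}^\top\mathbf{G}_i\mathbf{v}_{k-\lceil g_i\rceil}:\ \mathbf{G}_i\succ0\}$ (all $\mathbf{G}_i$ real symmetric positive definite). For $\mathbf{y}=(y_\alpha)_{\alpha\in\mathbb{N}^n_{2k}}$: $\mathbf{M}_d(\mathbf{y})=(y_{\alpha+\beta})_{\alpha,\beta\in\mathbb{N}^n_d}$,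 and for $q=\sum_\gamma q_\gamma\mathbf{x}^\gamma$, $\mathbf{M}_d(q\mathbf{y})=(\sum_\gamma q_\gamma y_{\alpha+\beta+\gamma})_{\alpha,\beta\in\mathbb{N}^n_d}$. $\mathcal{S}_k$: real symmetric block-diagonal matrices $\mathrm{diag}(\mathbf{X}_0,\dots,\mathbf{X}_m)$ with $\mathbf{X}_0$ of size $s(k)$, $\mathbf{X}_i$ of size $s(k-\lceil g_i\rceil)$. $\mathbf{D}_k(\mathbf{y}):=\mathrm{diag}(\mathbf{M}_k(\mathbf{y}),\mathbf{M}_{k-\lceil g_1\rceil}(g_1\mathbf{y}),\dots,\mathbf{M}_{k-\lceil g_m\rceil}(g_m\mathbf{y}))$. CTP: for every integer $k\ge k_{\min}$ there exist $a_k>0$ and a positive definite $\mathbf{P}_k\in\mathcal{S}_k$ such that every $\mathbf{y}\in\mathbb{R}^{s(2k)}$ with $\mathbf{M}_{k-\lceil h_j\rceil}(h_j\mathbf{y})=0$ ($j\in[l]$) and $y_{\mathbf{0}}=1$ satisfies $\mathrm{trace}(\mathbf{P}_k\mathbf{D}_k(\mathbf{y})\mathbf{P}_k)=a_k$. *)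

(* Defs.v *)
From HB Require Import structures.
From mathcomp Require Import all_boot all_order all_algebra.
From mathcomp Require Import reals.
From mathcomp Require Import mpoly.

Set Implicit Arguments.
Unset Strict Implicit.
Unset Printing Implicit Defensive.

Import Order.TTheory GRing.Theory Num.Theory.
Local Open Scope ring_scope.

Section POP.
Local Unset Implicit Arguments.
Variables (n : nat) (R : realType).
Local Notation poly := {mpoly R[n]}.

(* ceil(deg p / 2); deg p = msize p - 1 (deg 0 := 0) *)
Definition hdeg (p : poly) : nat := uphalf (msize p).-1.

Definition Nd (d : nat) : Type := 'X_{1..n < d.+1}.
Definition sz (d : nat) : nat := #|{: Nd d}|.

Definition mon (d : nat) (i : 'I_(sz d)) : 'X_{1..n} :=
  bmnm (@enum_val (Nd d) (mem {: Nd d}) i).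

Arguments mon {d}.

Definition vmon (d : nat) : 'cV[poly]_(sz d) := \col_i 'X_[mon i].

Definition posdef (p : nat) (G : 'M[R]_p) : Prop :=
  G^T = G /\ forall v : 'cV[R]_p, v != 0 -> 0 < (v^T *m G *m v) 0 0.

Arguments posdef {p}.

Definition qform (d : nat) (G : 'M[R]_(sz d)) : poly :=
  ((vmon d)^T *m map_mx (fun c => c%:MP) G *m vmon d) 0 0.

Arguments qform {d}.

Definition gext (g : seq poly) (i : nat) : poly := nth 0 (1 :: g) i.

Definition bsz (g : seq poly) (k : nat) (i : 'I_(size g).+1) : nat :=
  sz (k - hdeg (gext g i)).

Definition inQcirc (g : seq poly) (k : nat) (p : poly) : Prop :=
  exists G : forall i : 'I_(size g).+1, 'M[R]_(bsz g k i),
    (forall i, posdef (G i)) /\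
    p = \sum_(i < (size g).+1) gext g i * qform (G i).

Definition kmin (f : poly) (g h : seq poly) : nat :=
  maxn (hdeg f) (maxn (\max_(q <- g) hdeg q) (\max_(q <- h) hdeg q)).

(* y = (y_alpha)_{alpha in N^n_{2k}}, read at an arbitrary monomial
   (only ever used at monomials of degree <= 2k) *)
Definition yat (k : nat) (y : {ffun 'X_{1..n < (2 * k).+1} -> R})
    (a : 'X_{1..n}) : R :=
  if (insub a : option 'X_{1..n < (2 * k).+1}) is Some b then y b else 0.

Arguments yat {k}.

Definition Mmom (k : nat) (y : {ffun 'X_{1..n < (2 * k).+1} -> R}) (d : nat)
  : 'M[R]_(sz d) := \matrix_(i, j) yat y (mon i + mon j)%MM.

Definition Mloc (k : nat) (y : {ffun 'X_{1..n < (2 * k).+1} -> R}) (d : nat)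
  (q : poly) : 'M[R]_(sz d) :=
  \matrix_(i, j) \sum_(c <- msupp q) q@_c * yat y (mon i + mon j + c)%MM.

Arguments Mloc {k}.

(* D_k(y) = diag(M_k(y), M_{k-ceil g_1}(g_1 y), ...); block 0 is the
   localizing matrix of g_0 = 1, i.e. M_k(1 y) = M_k(y) *)
Definition Dk (g : seq poly) (k : nat) (y : {ffun 'X_{1..n < (2 * k).+1} -> R})
  : 'M[R]_(\sum_i bsz g k i) :=
  mxdiag (fun i : 'I_(size g).+1 =>
            Mloc y (k - hdeg (gext g i)) (gext g i) : 'M[R]_(bsz g k i)).

Definition CTP (f : poly) (g h : seq poly) : Prop :=
  forall k : nat, (kmin f g h <= k)%N ->
  exists a : R, 0 < a /\
  exists P : forall i : 'I_(size g).+1, 'M[R]_(bsz g k i),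
    posdef (mxdiag P) /\
    forall y : {ffun 'X_{1..n < (2 * k).+1} -> R},
      (forall j : 'I_(size h),
          Mloc y (k - hdeg (nth 0 h j)) (nth 0 h j) = 0) ->
      yat y 0%MM = 1 ->
      \tr (mxdiag P *m Dk g k y *m mxdiag P) = a.

End POP.

Arguments hdeg {n R}.
Arguments sz : clear implicits.
Arguments posdef {R p}.
Arguments qform {n R d}.
Arguments gext {n R}.
Arguments bsz {n R}.
Arguments inQcirc {n R}.
Arguments kmin {n R}.
Arguments yat {n R k}.
Arguments Mmom {n R k}.
Arguments Mloc {n R k}.
Arguments Dk {n R}.
Arguments CTP {n R}.

(* Main.v *)
Require Import Defs.
From HB Require Import structures.
From mathcomp Require Import all_boot all_order all_algebra.
From mathcomp Require Import reals.
From mathcomp Require Import mpoly.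
From mathcomp Require Import ssrcomplements zify ring lra.
From mathcomp Require boolp complex.

(* With s = ||x||^2, the identity
     (1 + R)^k - (1 + s)^k = (R - s) \sum_(i < k) (1 + R)^(k-1-i) (1 + s)^i
   writes the constant (1 + R)^k as v_k^T D v_k + (R - s) v_(k-1)^T F v_(k-1)
   with D and F diagonal and positive, since (1 + s)^i is the image of
   (1 + x_1 + ... + x_n)^i under x_j |-> x_j^2.  The other g_i are brought in
   with Gram matrix e I; their total has degree at most 2k, so it is e times
   some v_k^T W v_k with W symmetric, and D - e W stays positive definite for
   small e.

   For CTP, write 1 = \sum_i g_i v^T G_i v with G_i positive definite and let
   P_i be the square root of G_i: the trace of P D_k(y) P is the Riesz
   functional of y evaluated at 1.  The square root is p(G_i)^2, where the real
   polynomial p interpolates the fourth root on the spectrum of G_i, so that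
   it is symmetric and positive for free. *)

Set Implicit Arguments.
Unset Strict Implicit.
Unset Printing Implicit Defensive.

Import Order.TTheory GRing.Theory Num.Theory.
Local Open Scope ring_scope.

(** * Interpolation and square roots of positive definite matrices *)

Lemma poly_interpolation (F : fieldType) (s : seq F) (f : F -> F) :
  exists p : {poly F}, {in s, forall x, p.[x] = f x}.
Proof.
elim: s => [|a s [p Hp]]; first by exists 0.
have [ais|ans] := boolP (a \in s).
  by exists p => x; rewrite inE => /predU1P[->|]; apply: Hp.
(* [w] vanishes on [s] but not at [a], so adding a multiple of it corrects the value at [a]
   alone. *)
pose w : {poly F} := \prod_(b <- s) ('X - b%:P).
have wa : w.[a] != 0 by rewrite -[_ == 0]/(root w a) root_prod_XsubC.
exists (p + ((f a - p.[a]) / w.[a]) *: w) => x.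
rewrite inE hornerD hornerZ => /predU1P[->|xs].
  by rewrite divfK// addrC subrK.
have /eqP -> : w.[x] == 0 by rewrite -[_ == 0]/(root w x) root_prod_XsubC.
by rewrite mulr0 addr0 Hp.
Qed.

Section SymmetricMatrix.
Import complex ComplexField.
Variable R : rcfType.
Local Notation toC := (map_mx (real_complex R)).

(** Over [R[i]] a real symmetric matrix is hermitian, so the spectral theorem applies; its
    eigenvalues are real, and only [P] is left complex. *)
Lemma sym_complex_diag n (A : 'M[R]_n) : A^T = A ->
  exists (P : 'M[R[i]]_n) (d : 'rV[R]_n),
    P \in unitmx /\ toC A = invmx P *m diag_mx (toC d) *m P.
Proof.
move=> symA.
have hA : toC A \is hermsymmx.
  apply: realsym_hermsym.
    by apply/is_hermitianmxP; rewrite expr0 scale1r map_mx_id// map_trmx symA.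
  by apply/mxOverP => i j; rewrite mxE complex_real.
have /orthomx_spectralP AE := hermitian_normalmx hA.
exists (spectralmx (toC A)), (\row_j complex.Re (spectral_diag (toC A) 0 j)).
split; first exact: spectral_unit.
rewrite {1}AE; congr (_ *m diag_mx _ *m _).
apply/rowP => j; rewrite !mxE.
have /mxOverP/(_ 0 j) := hermitian_spectral_diag_real hA.
by move/RRe_real.
Qed.

(** After diagonalisation over [R[i]], it suffices that [p ^+ 4] fix each eigenvalue. As [p] has
    real coefficients, [p(A)] is real although [P] is not. *)
Lemma sqrt4_horner_mx n (A : 'M[R]_n.+1) : A^T = A ->
  (forall a, eigenvalue A a -> 0 <= a) ->
  exists p : {poly R}, horner_mx A (p ^+ 4) = A.
Proof.
move=> symA posA.
have [P [d [uP AE]]] := sym_complex_diag symA.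
(* Row [j] of [P] is a complex left eigenvector; since [posA] speaks of [A] over [R], the eigenvalue
   is carried over as a root of the characteristic polynomial. *)
have d_ge0 j : 0 <= d 0 j.
  apply: posA; rewrite eigenvalue_root_char -(fmorph_root (real_complex R)).
  rewrite map_char_poly -eigenvalue_root_char; apply/eigenvalueP.
  exists (row j P).
    rewrite AE -row_mul !mulmxA mulmxV// mul1mx row_mul row_diag_mx -scalemxAl.
    by rewrite -rowE mxE.
  apply/eqP => /(congr1 (mulmx^~ (invmx P))).
  rewrite -row_mul mulmxV// mul0mx => /rowP/(_ j).
  by rewrite !mxE eqxx => /eqP; rewrite oner_eq0.
have [p pE] := poly_interpolation (codom (d 0)) (Num.sqrt \o Num.sqrt).
exists p; apply: (@map_mx_inj _ _ (real_complex R)).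
rewrite map_horner_mx {1}AE horner_mx_uconjC// horner_mx_diag [RHS]AE.
congr (_ *m diag_mx _ *m _); apply/rowP => j; rewrite !mxE horner_map/=.
rewrite horner_exp pE ?codom_f//=.
by rewrite (exprM _ 2 2) !sqr_sqrtr ?sqrtr_ge0.
Qed.

End SymmetricMatrix.

Lemma form_sqr_ge0 (R : realDomainType) n (v : 'cV[R]_n) : 0 <= (v^T *m v) 0 0.
Proof. by rewrite mxE sumr_ge0// => i _; rewrite mxE -expr2 sqr_ge0. Qed.

Lemma form_sqr_eq0 (R : realDomainType) n (v : 'cV[R]_n) :
  ((v^T *m v) 0 0 == 0) = (v == 0).
Proof.
apply/eqP/eqP => [|->]; last by rewrite mulmx0 mxE.
rewrite mxE => /eqP; rewrite psumr_eq0 => [/allP v0|i _]; last first.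
  by rewrite mxE -expr2 sqr_ge0.
apply/colP => i; have := v0 i (mem_index_enum _).
by rewrite !mxE mulf_eq0 orbb => /eqP.
Qed.

Lemma horner_mx_sym (R : comNzRingType) n (A : 'M[R]_n.+1) (p : {poly R}) :
  A^T = A -> (horner_mx A p)^T = horner_mx A p.
Proof.
move=> symA; elim/poly_ind: p => [|p c IHp]; first by rewrite rmorph0 trmx0.
rewrite rmorphD rmorphM/= horner_mx_C horner_mx_X linearD/= tr_scalar_mx.
rewrite trmx_mul IHp symA; congr (_ + _).
exact/esym/comm_horner_mx.
Qed.

(** With [B] symmetric, the form of [B *m B] is $\|Bv\|^2$, and $Bv=0$ would force $v^T G v=0$.
    Polynomial evaluation requires size [n.+1], so the empty matrix is treated apart. *)
Lemma posdef_sqrt (R : realType) n (G : 'M[R]_n) :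
  posdef G -> exists P : 'M[R]_n, posdef P /\ P *m P = G.
Proof.
case: n G => [|n] G [symG posG].
  exists 0; split; last by apply/matrixP => -[].
  split; first by rewrite trmx0.
  by move=> v /eqP; case; apply/colP => -[].
have [|p pG] := @sqrt4_horner_mx _ _ G symG.
  move=> a /eigenvalueP[v vG v0].
  have vT0 : v^T != 0 by rewrite -trmx0 (inj_eq trmx_inj).
  have := posG _ vT0; rewrite trmxK vG -scalemxAl mxE => /ltW.
  have := form_sqr_ge0 v^T; have := form_sqr_eq0 v^T; rewrite trmxK => v2 v2_ge0.
  by rewrite pmulr_lge0// lt_neqAle v2_ge0 andbT eq_sym v2.
pose B := horner_mx G p.
have symB : B^T = B by exact: horner_mx_sym.
have BB : B *m B *m (B *m B) = G.
  by rewrite -[RHS]pG rmorphXn/= (exprM _ 2 2) !expr2.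
exists (B *m B); split=> //; split; first by rewrite trmx_mul symB.
move=> v v0; have -> : v^T *m (B *m B) *m v = (B *m v)^T *m (B *m v).
  by rewrite trmx_mul symB !mulmxA.
rewrite lt_neqAle form_sqr_ge0 andbT eq_sym form_sqr_eq0.
apply: contraTneq (posG v v0) => Bv0.
by rewrite -BB -!mulmxA Bv0 !mulmx0 mxE ltxx.
Qed.

(** * Gram matrices of polynomials *)

Section QuadraticForms.
Variables (n : nat) (R : realType).
Implicit Types (p q : {mpoly R[n]}) (d : nat).
Local Notation mon i := (Defs.mon _ _ i).

Lemma qformE d (G : 'M[R]_(sz n d)) :
  qform G = \sum_i \sum_j G i j *: 'X_[mon i + mon j].
Proof.
rewrite /qform mxE exchange_big/=; apply: eq_bigr => j _.
rewrite mxE mulr_suml; apply: eq_bigr => i _.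
by rewrite !mxE mpolyXD -mul_mpolyC mulrCA !mulrA.
Qed.

Lemma qform_is_linear d : linear (@qform n R d).
Proof.
move=> a A B; rewrite !qformE scaler_sumr -big_split/=; apply: eq_bigr => i _.
rewrite scaler_sumr -big_split/=; apply: eq_bigr => j _.
by rewrite !mxE scalerDl scalerA.
Qed.

HB.instance Definition _ d :=
  GRing.isLinear.Build R 'M[R]_(sz n d) {mpoly R[n]} *:%R (@qform n R d)
    (@qform_is_linear d).

Lemma qform_tr d (G : 'M[R]_(sz n d)) : qform G^T = qform G.
Proof.
rewrite !qformE exchange_big/=; apply: eq_bigr => i _; apply: eq_bigr => j _.
by rewrite mxE addmC.
Qed.

Lemma qform_diag d (D : 'rV[R]_(sz n d)) :
  qform (diag_mx D) = \sum_i D 0 i *: 'X_[mon i + mon i].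
Proof.
rewrite qformE; apply: eq_bigr => i _; rewrite (bigD1 i)//= mxE eqxx mulr1n.
by rewrite big1 ?addr0// => j /negbTE ji; rewrite mxE eq_sym ji mulr0n scale0r.
Qed.

Lemma mdeg_mon d (i : 'I_(sz n d)) : (mdeg (mon i) <= d)%N.
Proof. by rewrite -ltnS bmdeg. Qed.

Lemma mon_surj d (m : 'X_{1..n}) :
  (mdeg m <= d)%N -> exists i : 'I_(sz n d), mon i = m.
Proof.
rewrite -ltnS => md; exists (enum_rank (BMultinom md)).
by rewrite /Defs.mon enum_rankK.
Qed.

Lemma big_mon d (F : 'X_{1..n} -> {mpoly R[n]}) :
  \sum_(i < sz n d) F (mon i) = \sum_(m : 'X_{1..n < d.+1}) F m.
Proof. by rewrite [RHS]big_enum_val. Qed.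

(** Variables are added to [a] one at a time: as long as its degree is below that of [m], some
    exponent can still grow. *)
Lemma mnm_split (m : 'X_{1..n}) d : (d <= mdeg m)%N ->
  exists2 a : 'X_{1..n}, (a <= m)%MM & mdeg a = d.
Proof.
elim: d => [|d IHd] dm.
  by exists 0%MM; rewrite ?mdeg0//; apply/mnm_lepP => i; rewrite mnm0E.
have [a am ad] := IHd (ltnW dm).
have /existsP[i ai] : [exists i, a i < m i]%N.
  apply: contraLR dm; rewrite negb_exists => /forallP ma.
  rewrite -leqNgt -ad !mdegE leq_sum// => i _.
  by rewrite leqNgt.
exists (a + U_(i))%MM; last by rewrite mdegD mdeg1 ad addn1.
apply/mnm_lepP => j; rewrite mnmDE mnm1E.
by case: eqP => [<-|_]; rewrite ?addn1// addn0; apply/mnm_lepP.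
Qed.

Lemma gram_exists d p : (msize p <= (d + d).+1)%N ->
  exists2 W : 'M[R]_(sz n d), W^T = W & p = qform W.
Proof.
move=> pd; suff [W pW] : exists W : 'M[R]_(sz n d), p = qform W.
  (* [qform] only sees the symmetric part of a matrix. *)
  exists (2^-1 *: (W + W^T)); first by rewrite linearZ linearD/= trmxK addrC.
  rewrite linearZ linearD/= qform_tr -pW -mulr2n -scaler_nat scalerA.
  by rewrite mulVf ?scale1r// pnatr_eq0.
rewrite (mpolywE pd); elim/big_ind: _ => [|_ _ [A ->] [B ->]|[m /= md] _].
- by exists 0; rewrite linear0.
- by exists (A + B); rewrite linearD.
(* The factor [a] has degree $\min(\deg m, d)$, so the cofactor [m - a] has degree at most $d$
   too. *)
have [a am ad] := mnm_split (geq_minl (mdeg m) d).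
have ab : m = (m - a + a)%MM by rewrite submK.
have bd : (mdeg (m - a) <= d)%N.
  have := congr1 (@mdeg n) ab; rewrite mdegD ad => mE.
  move: md; rewrite mE; case: (leqP (mdeg m) d) => md; lia.
have {}ad : (mdeg a <= d)%N by rewrite ad geq_minr.
have [[i ia] [j jb]] := (mon_surj bd, mon_surj ad).
exists (p@_m *: delta_mx i j); rewrite linearZ/= qformE; congr (_ *: _).
rewrite (bigD1 i)//= (bigD1 j)//= mxE !eqxx scale1r ia jb -ab.
rewrite !big1 ?addr0// => [i' /negbTE i'i|j' /negbTE j'j].
  by rewrite big1// => j' _; rewrite mxE i'i scale0r.
by rewrite mxE j'j andbF scale0r.
Qed.

End QuadraticForms.

(** * The Riesz functional of a moment sequence *)

Section RieszFunctional.
Variables (n : nat) (R : realType) (Y : 'X_{1..n} -> R).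
Implicit Types p q : {mpoly R[n]}.

Definition riesz p : R := \sum_(m <- msupp p) p@_m * Y m.

(** Replaces the support, which varies with [p], by a common index set, on which linearity is
    checked coefficientwise. *)
Lemma rieszwE d p : (msize p <= d)%N ->
  riesz p = \sum_(m : 'X_{1..n < d}) p@_m * Y m.
Proof.
move=> pd; rewrite /riesz (big_mksub 'X_{1..n < d}) ?msupp_uniq//=; last first.
  by move=> x /msize_mdeg_lt /leq_trans; apply.
by rewrite big_rmcond//= => m /memN_msupp_eq0 ->; rewrite mul0r.
Qed.

Lemma riesz_is_linear : scalar riesz.
Proof.
move=> a p q; pose d := maxn (msize (a *: p + q)) (maxn (msize p) (msize q)).
rewrite !(@rieszwE d) ?leq_max ?leqnn ?orbT// mulr_sumr -big_split/=.
by apply: eq_bigr => m _; rewrite mcoeffD mcoeffZ mulrDl mulrA.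
Qed.

HB.instance Definition _ :=
  GRing.isLinear.Build R {mpoly R[n]} R *%R riesz riesz_is_linear.

Lemma rieszX m : riesz 'X_[m] = Y m.
Proof. by rewrite /riesz msuppX big_seq1 mcoeffX eqxx mul1r. Qed.

Lemma rieszMX p m : riesz (p * 'X_[m]) = \sum_(c <- msupp p) p@_c * Y (m + c)%MM.
Proof.
rewrite {1}[p]mpolyE mulr_suml linear_sum; apply: eq_bigr => c _.
by rewrite -scalerAl linearZ/= -mpolyXD rieszX addmC.
Qed.

End RieszFunctional.

(** * Constant trace from a representation of 1 *)

Lemma mul_mxdiag (R : pzSemiRingType) p (s : 'I_p -> nat)
    (A B : forall i, 'M[R]_(s i)) :
  mxdiag A *m mxdiag B = mxdiag (fun i => A i *m B i).
Proof.
rewrite {2}/mxdiag mul_mxdiag_mxblock; apply/eq_mxblock => i j.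
by case: eqVneq => [<-|_]; rewrite ?conform_mx_id// mulmx0.
Qed.

Section ConstantTrace.
Variables (n : nat) (R : realType).
Implicit Types (g : seq {mpoly R[n]}).

(** The entries of [Mloc y d q] are the values of the functional at [q] times the products of two
    basis monomials, and the trace weights them by [G]. *)
Lemma mxtrace_Mloc k (y : {ffun 'X_{1..n < (2 * k).+1} -> R}) d q
    (G : 'M[R]_(sz n d)) :
  \tr (G *m Mloc y d q) = riesz (yat y) (q * qform G).
Proof.
rewrite qformE mulr_sumr linear_sum; apply: eq_bigr => i _.
rewrite mulr_sumr linear_sum mxE; apply: eq_bigr => j _.
by rewrite -scalerAr linearZ/= rieszMX mxE addmC.
Qed.

Lemma posdef_mxdiag p (s : 'I_p -> nat) (P : forall i, 'M[R]_(s i)) :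
  (forall i, posdef (P i)) -> posdef (mxdiag P).
Proof.
move=> posP; split.
  by rewrite tr_mxdiag; apply/eq_mxdiag => i; case: (posP i).
move=> v; rewrite -[v]submxcolK => v0.
rewrite tr_mxcol mul_mxrow_mxdiag mul_mxrow_mxcol summxE.
have form_ge0 i : 0 <= ((submxcol v i)^T *m P i *m submxcol v i) 0 0.
  have [->|/(posP i).2/ltW//] := eqVneq (submxcol v i) 0.
  by rewrite mulmx0 mxE.
rewrite lt_neqAle sumr_ge0// andbT eq_sym psumr_eq0//.
apply: contra v0 => /allP form0.
apply/eqP; rewrite -[RHS]mxcol0; apply/eq_mxcol => i; apply/eqP.
apply: contraTT (form0 i (mem_index_enum _)) => /(posP i).2.
by rewrite lt_def => /andP[].
Qed.

Lemma constant_trace g k : inQcirc g k 1 ->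
  exists P : forall i : 'I_(size g).+1, 'M[R]_(bsz g k i),
    posdef (mxdiag P) /\
    forall y : {ffun 'X_{1..n < (2 * k).+1} -> R}, yat y 0%MM = 1 ->
      \tr (mxdiag P *m Dk g k y *m mxdiag P) = 1.
Proof.
move=> [G [posG G1]].
pose P i := projT1 (boolp.cid (posdef_sqrt (posG i))).
have [posP PP] : (forall i, posdef (P i)) /\ (forall i, P i *m P i = G i).
  by split=> i; rewrite /P; case: boolp.cid => /= ? [].
exists P; split; first exact: posdef_mxdiag.
(* Cyclicity of the trace brings the two factors [P] together, and blockwise their product is
   [G i]. *)
move=> y y1; rewrite mxtrace_mulC mulmxA.
rewrite mul_mxdiag /Dk mul_mxdiag mxtrace_mxdiag.
under eq_bigr do rewrite PP mxtrace_Mloc.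
by rewrite -linear_sum -G1 /= -(@mpolyX0 n R) rieszX.
Qed.

End ConstantTrace.

(** * Positive definite perturbations and positive coefficients *)

Section Positivity.
Variables (n : nat) (R : realType).
Implicit Types (p q : {mpoly R[n]}).

Lemma posdefZ d (a : R) (G : 'M[R]_d) : 0 < a -> posdef G -> posdef (a *: G).
Proof.
move=> a0 [symG posG]; split; first by rewrite linearZ/= symG.
by move=> v /posG vG; rewrite -scalemxAr -scalemxAl mxE mulr_gt0.
Qed.

Lemma posdef1 d : posdef (1%:M : 'M[R]_d).
Proof.
split; first by rewrite trmx1.
by move=> v v0; rewrite mulmx1 lt_def form_sqr_eq0 v0 form_sqr_ge0.
Qed.

Lemma posdef_diag_perturb d (D : 'rV[R]_d) (W : 'M[R]_d) :
  (forall i, 0 < D 0 i) -> W^T = W ->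
  exists2 e : R, 0 < e & posdef (diag_mx D - e *: W).
Proof.
move=> posD symW.
have [c c0 cD] : exists2 c, 0 < c & forall i, c <= D 0 i.
  (* The default 1 keeps the minimum positive when [d = 0]. *)
  exists (\big[Order.min/1]_i D 0 i) => [|i]; last exact: bigmin_le_cond.
  by apply/lt_bigmin.
pose M := \sum_i \sum_j `|W i j|.
have M0 : 0 <= M by rewrite !sumr_ge0// => i _; rewrite sumr_ge0.
(* The form of [W] is at most $M\|v\|^2$ and that of [D] at least $c\|v\|^2$; this choice gives
   $eM<c$ even when $M=0$. *)
exists (c / (M + 1)); first by rewrite divr_gt0// ltr_pwDr.
split; first by rewrite linearB linearZ/= tr_diag_mx symW.
move=> v v0.
have Dv : c * (v^T *m v) 0 0 <= (v^T *m diag_mx D *m v) 0 0.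
  rewrite mul_mx_diag !mxE mulr_sumr ler_sum// => i _.
  by rewrite !mxE [_ * D 0 i]mulrC -mulrA ler_wpM2r// -expr2 sqr_ge0.
have v2_ge0 := form_sqr_ge0 v.
have v2_gt0 : 0 < (v^T *m v) 0 0 by rewrite lt_def form_sqr_eq0 v0.
have v2_ge i : v i 0 ^+ 2 <= (v^T *m v) 0 0.
  rewrite mxE (bigD1 i)//= mxE -expr2 lerDl sumr_ge0// => j _.
  by rewrite mxE -expr2 sqr_ge0.
have Wv : (v^T *m W *m v) 0 0 <= M * (v^T *m v) 0 0.
  rewrite mxE /M exchange_big/= mulr_suml ler_sum// => j _.
  rewrite mxE !mulr_suml ler_sum// => i _; rewrite mxE.
  rewrite [v i 0 * _]mulrC -mulrA (le_trans (ler_norm _))// normrM.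
  rewrite ler_wpM2l// ler_norml.
  by have := v2_ge i; have := v2_ge j; set S := (_ *m _) 0 0; nra.
rewrite mulmxBr mulmxBl -scalemxAr -scalemxAl [X in 0 < X]mxE.
rewrite [X in _ + X]mxE [X in _ - X]mxE subr_gt0 (lt_le_trans _ Dv)//.
rewrite (le_lt_trans (ler_wpM2l _ Wv))//.
  by rewrite divr_ge0 ?addr_ge0// ltW.
rewrite mulrA ltr_pM2r// mulrAC ltr_pdivrMr; first by rewrite ltr_pM2l// ltrDl.
by rewrite ltr_pwDr.
Qed.

(** Induction on [d]: a monomial of degree at most [d] survives from the factor 1, one of degree
    [d.+1] comes from some ['X_i] dividing it. Nonnegativity rules out cancellation by the other
    terms. *)
Lemma mcoeff_linear_pow d (m : 'X_{1..n}) :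
  let p := (1 + \sum_(i < n) 'X_i) ^+ d : {mpoly R[n]} in
  0 <= p@_m /\ ((mdeg m <= d)%N -> 0 < p@_m).
Proof.
elim: d m => [|d IHd] m /=.
  rewrite expr0 mcoeff1; split; first exact: ler0n.
  by rewrite leqn0 mdeg_eq0 => ->.
set p := _ ^+ d in IHd *.
have pX_ge0 i : 0 <= (p * 'X_i)@_m.
  have [mi|mi] := boolP (U_(i) <= m)%MM.
    by rewrite -(submK mi) addmC mcoeffMX; case: (IHd (m - U_(i))%MM).
  rewrite memN_msupp_eq0//; apply: contra mi.
  rewrite (perm_mem (msuppMX _ _)) => /mapP[m' _ ->].
  exact: lem_addr.
rewrite exprSr mulrDr mulr1 mulr_sumr mcoeffD raddf_sum/=.
have [pm_ge0 pm_gt0] := IHd m; split; first by rewrite addr_ge0 ?sumr_ge0.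
rewrite leq_eqVlt ltnS => /predU1P[md|/pm_gt0 pm]; last first.
  by rewrite ltr_wpDr// sumr_ge0.
have [i mi] : exists i, m i != 0%N.
  apply/existsP; apply: contraTT isT => /existsPn m0.
  move: md; rewrite mdegE big1// => i _.
  by apply/eqP; rewrite -[_ == _]negbK m0.
rewrite ltr_wpDl// (bigD1 i)//= ltr_wpDr ?sumr_ge0//.
have {}mi : (U_(i) <= m)%MM by rewrite lep1mP.
have mE := submK mi; rewrite -mE addmC mcoeffMX; apply: (IHd _).2.
by rewrite -ltnS -md -[in leqRHS]mE mdegD mdeg1 addn1.
Qed.

Lemma msizeM_leq p q : (msize (p * q) <= (msize p + msize q).-1)%N.
Proof.
have [->|p0] := eqVneq p 0; first by rewrite mul0r msize0.
have [->|q0] := eqVneq q 0; first by rewrite mulr0 msize0.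
by rewrite msizeM.
Qed.

Lemma msize_linear_pow d :
  (msize ((1 + \sum_(i < n) 'X_i) ^+ d : {mpoly R[n]}) <= d.+1)%N.
Proof.
elim: d => [|d IHd]; first by rewrite expr0 msize1.
rewrite exprSr (leq_trans (msizeM_leq _ _))//.
have : (msize (1 + \sum_(i < n) 'X_i : {mpoly R[n]}) <= 2)%N.
  rewrite (leq_trans (msizeD_le _ _))// geq_max msize1 (leq_trans (msize_sum _ _ _))//.
  by apply/bigmax_leqP => i _; rewrite msizeX mdeg1.
lia.
Qed.

(** Squaring the variables sends $x^m$ to $x^{m+m}$, which is a diagonal entry of $v_d v_d^T$; the
    coefficients of [p] thus become the diagonal. *)
Lemma qform_square_comp d p :
  (msize p <= d.+1)%N -> (forall m, (mdeg m <= d)%N -> 0 < p@_m) ->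
  exists2 D : 'rV[R]_(sz n d), (forall i, 0 < D 0 i) &
    p \mPo [tuple 'X_i ^+ 2 | i < n] = qform (diag_mx D).
Proof.
move=> pd p_gt0; exists (\row_i p@_(Defs.mon _ _ i)).
  by move=> i; rewrite mxE p_gt0// mdeg_mon.
rewrite qform_diag; under eq_bigr do rewrite mxE.
rewrite (big_mon d (fun m => p@_m *: 'X_[m + m])).
rewrite {1}(mpolywE pd) raddf_sum; apply: eq_bigr => m _ /=.
rewrite comp_mpolyZ comp_mpolyX mpolyXE_id; congr (_ *: _).
apply: eq_bigr => i _; rewrite tnth_mktuple mnmDE addnn -exprM mulnC.
by rewrite muln2.
Qed.

End Positivity.

(** * Positive constants from the ball constraint *)

Section Ball.
Variables (n : nat) (R : realType).
Implicit Types (p q : {mpoly R[n]}).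

(** Without variables the polynomial is the constant [r], of half-degree 0; otherwise a square has
    coefficient -1 and the degree is 2. *)
Lemma hdeg_ball (r : R) : 0 < r ->
  hdeg (r%:MP - \sum_(i < n) 'X_i ^+ 2 : {mpoly R[n]}) = (0 < n)%N.
Proof.
move=> r0; case: posnP => [n0|n_gt0].
  have -> : \sum_(i < n) 'X_i ^+ 2 = 0 :> {mpoly R[n]}.
    by apply: big1 => i; have := ltn_ord i; rewrite {2}n0.
  by rewrite subr0 /hdeg msizeC gt_eqF.
pose i0 := Ordinal n_gt0.
rewrite /hdeg; suff -> : msize (r%:MP - \sum_(i < n) 'X_i ^+ 2 : {mpoly R[n]}) = 3%N.
  by [].
apply/eqP; rewrite eqn_leq; apply/andP; split.
  rewrite (leq_trans (msizeD_le _ _))// geq_max msizeC msizeN.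
  rewrite (leq_trans (leq_b1 _))//= (leq_trans (msize_sum _ _ _))//.
  by apply/bigmax_leqP => i _; rewrite mpolyXn msizeX mdegMn mdeg1.
have := @msize_mdeg_lt _ _ (r%:MP - \sum_(i < n) 'X_i ^+ 2) (U_(i0) *+ 2)%MM.
rewrite mdegMn mdeg1 mul1n; apply; rewrite mcoeff_msupp mcoeffB mcoeffC.
rewrite -mdeg_eq0 mdegMn mdeg1 mul1n mulr0 sub0r oppr_eq0 raddf_sum (bigD1 i0)//=.
rewrite mcoeffXn eqxx big1 ?addr0 ?oner_eq0// => i ii0.
rewrite mcoeffXn; case: eqP => // /mnmP/(_ i).
by rewrite !mulmnE !mnm1E eqxx eq_sym (negbTE ii0).
Qed.

Lemma ball_representation (r : R) k :
  let b := r%:MP - \sum_(i < n) 'X_i ^+ 2 : {mpoly R[n]} in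
  0 < r -> (hdeg b <= k)%N ->
  exists (D : 'rV[R]_(sz n k)) (G : 'M[R]_(sz n (k - hdeg b))) (c : R),
    [/\ forall i, 0 < D 0 i, posdef G, 0 < c &
        c%:MP = qform (diag_mx D) + b * qform G].
Proof.
move=> b r0 bk; set e := (k - hdeg b)%N.
have r1_gt0 : 0 < 1 + r by rewrite addr_gt0.
pose sq : n.-tuple {mpoly R[n]} := [tuple 'X_i ^+ 2 | i < n].
pose u d : {mpoly R[n]} := (1 + \sum_(i < n) 'X_i) ^+ d.
have u_comp d : u d \mPo sq = (1 + \sum_(i < n) 'X_i ^+ 2) ^+ d.
  rewrite rmorphXn rmorphD rmorph1 rmorph_sum /=; congr ((_ + _) ^+ _).
  by apply: eq_bigr => i _; rewrite comp_mpolyXU -tnth_nth tnth_mktuple.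
(* if [n = 0] then [k = e] rather than [e.+1], but every exponent is 0 *)
have degE (m : 'X_{1..n}) : (mdeg m <= k)%N = (mdeg m <= e.+1)%N.
  rewrite /e /b hdeg_ball //; move: bk; rewrite /b hdeg_ball //.
  case: posnP => [n0 _|_ k_gt0]; last by rewrite subn1 prednK.
  have -> : mdeg m = 0%N; last by [].
  by rewrite mdegE big1// => i _; have := ltn_ord i; rewrite {2}n0.
have [||D D0 DE] := @qform_square_comp n R k (u e.+1).
- rewrite msizeE; apply/bigmax_leqP_seq => m mu _; rewrite ltnS degE -ltnS.
  exact: leq_trans (msize_mdeg_lt mu) (msize_linear_pow _ _ _).
- by move=> m; rewrite degE => /(mcoeff_linear_pow R e.+1 m).2.
(* Before squaring the variables, this is the cofactor of $(1+r)-(1+s)$ in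
   $(1+r)^{e+1}-(1+s)^{e+1}$. *)
pose w := \sum_(i < e.+1) (1 + r) ^+ (e - i) *: u i.
have [||F F0 FE] := @qform_square_comp n R e w.
- rewrite (leq_trans (msize_sum _ _ _))//; apply/bigmax_leqP => i _.
  rewrite (leq_trans (msizeZ_le _ _))// (leq_trans (msize_linear_pow _ _ _))//.
(* The last summand [u e] already contains every monomial of degree at most [e]; the others only add
   nonnegative terms. *)
- move=> m me; rewrite raddf_sum (bigD1 ord_max)//= mcoeffZ subnn expr0 mul1r.
  rewrite ltr_pwDl//; first exact: (mcoeff_linear_pow R e m).2.
  rewrite sumr_ge0// => i _; rewrite mcoeffZ mulr_ge0 ?exprn_ge0 ?(ltW r1_gt0)//.
  by have [] := mcoeff_linear_pow R i m.
exists D, (diag_mx F), ((1 + r) ^+ e.+1); split=> //.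
(* A positive diagonal is positive definite: perturbation by [W = 0]. *)
- by have [c _] := posdef_diag_perturb F0 (trmx0 _ _ _); rewrite scaler0 subr0.
- exact: exprn_gt0.
apply/eqP; rewrite -DE -FE u_comp [eqbRHS]addrC -subr_eq rmorphXn/= subrXX; apply/eqP.
congr (_ * _); first by rewrite mpolyCD mpolyC1 /b; ring.
rewrite raddf_sum; apply: eq_bigr => i _ /=.
by rewrite comp_mpolyZ u_comp -rmorphXn -mul_mpolyC.
Qed.

End Ball.

(** * Membership of positive constants in the interior of the quadratic module *)

Section Putinar.
Variables (n : nat) (R : realType).
Implicit Types (p q : {mpoly R[n]}).

Lemma leq_hdeg p : (msize p <= (hdeg p + hdeg p).+1)%N.
Proof. by rewrite /hdeg; have := uphalfK (msize p).-1; lia. Qed.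

Lemma msize_qform d (G : 'M[R]_(sz n d)) : (msize (qform G) <= (d + d).+1)%N.
Proof.
rewrite qformE (leq_trans (msize_sum _ _ _))//; apply/bigmax_leqP => i _.
rewrite (leq_trans (msize_sum _ _ _))//; apply/bigmax_leqP => j _.
by rewrite (leq_trans (msizeZ_le _ _))// msizeX ltnS mdegD leq_add ?mdeg_mon.
Qed.

Lemma hdeg_gext (f : {mpoly R[n]}) (g h : seq {mpoly R[n]}) k
    (i : 'I_(size g).+1) :
  (kmin f g h <= k)%N -> (hdeg (gext g i) <= k)%N.
Proof.
rewrite !geq_max => /and3P[_ gk _].
case: i => -[|i] /= ig; first by rewrite /hdeg msize1.
by apply: leq_trans gk; apply: (@leq_bigmax_seq _ g xpredT hdeg) => //; exact: mem_nth.
Qed.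

(** The type of the Gram matrix depends on [i]; a case distinction on [i] is made on polynomials
    instead, and choice recovers the matrices. *)
Lemma inQcircP (g : seq {mpoly R[n]}) k p :
  (exists2 s : 'I_(size g).+1 -> {mpoly R[n]},
     (forall i, exists2 G : 'M[R]_(bsz g k i), posdef G & s i = qform G) &
     p = \sum_(i < (size g).+1) gext g i * s i) -> inQcirc g k p.
Proof.
move=> [s sG ->]; exists (fun i => s2val (boolp.cid2 (sG i))).
split=> [i|]; first by case: boolp.cid2.
by apply: eq_bigr => i _; case: boolp.cid2 => /= G _ <-.
Qed.

Lemma inQcirc_gt0 (f : {mpoly R[n]}) (g h : seq {mpoly R[n]}) (r : R) k a :
  0 < r -> r%:MP - \sum_(i < n) 'X_i ^+ 2 \in g ->
  (kmin f g h <= k)%N -> 0 < a -> inQcirc g k a%:MP.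
Proof.
move=> r0 bg kk a0; have gk i := @hdeg_gext f g h k i kk.
pose b : {mpoly R[n]} := r%:MP - \sum_(i < n) 'X_i ^+ 2.
have [j j0 jb] : exists2 j : 'I_(size g).+1, j != ord0 & gext g j = b.
  have bi : (index b g < size g)%N by rewrite index_mem.
  by exists (lift ord0 (Ordinal bi)) => //; rewrite /gext /= nth_index.
have := @ball_representation n R r k r0; rewrite -/b -jb => /(_ (gk j)).
move=> [D [G [c [D0 posG c0 cE]]]].
pose q (i : 'I_(size g).+1) : {mpoly R[n]} := gext g i * qform (1%:M : 'M[R]_(bsz g k i)).
have [|W symW WE] :=
    @gram_exists n R k (\sum_(i | (i != ord0) && (i != j)) q i).
  rewrite (leq_trans (msize_sum _ _ _))//; apply/bigmax_leqP => i _.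
  rewrite (leq_trans (msizeM_leq _ _))//.
  have := msize_qform (1%:M : 'M[R]_(bsz g k i)).
  have := leq_hdeg (gext g i); have := gk i; rewrite /bsz.
  set u := mmeasure _ _; set v := mmeasure _ _; set w := hdeg _.
  lia.
have [e e0 posDW] := posdef_diag_perturb D0 symW.
apply: inQcircP.
have ac0 : 0 < a / c by rewrite divr_gt0.
(* Block 0 absorbs the total [e *: qform W] of the blocks with Gram matrix [e *: 1%:M]; the factor
   [a / c] turns the constant [c] into [a]. *)
exists (fun i => (a / c) *: (if i == ord0 then qform (diag_mx D - e *: W)
   else if i == j then qform G else e *: qform (1%:M : 'M[R]_(bsz g k i)))).
  move=> i; have [->|i0] := eqVneq i ord0.
    rewrite /bsz; have -> : (k - hdeg (gext g ord0))%N = k.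
      by rewrite /gext/= /hdeg msize1 subn0.
    exists ((a / c) *: (diag_mx D - e *: W)); first exact: posdefZ.
    by rewrite [in RHS]linearZ.
  have [->|ij] := eqVneq i j.
    by exists ((a / c) *: G); [exact: posdefZ | rewrite [in RHS]linearZ].
  exists ((a / c * e) *: 1%:M); last by rewrite scalerA [in RHS]linearZ.
  by apply: posdefZ; [rewrite mulr_gt0|exact: posdef1].
have -> : a%:MP = (a / c) *: c%:MP :> {mpoly R[n]}.
  by rewrite -mul_mpolyC -mpolyCM divfK// gt_eqF.
under eq_bigr do rewrite -scalerAr.
rewrite -scaler_sumr; congr (_ *: _).
rewrite (bigD1 ord0)// (bigD1 j)//= (negbTE j0) eqxx.
have -> : \sum_(i < (size g).+1 | (i != ord0) && (i != j))
     gext g i * (if i == ord0 then qform (diag_mx D - e *: W)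
   else if i == j then qform G else e *: qform (1%:M : 'M[R]_(bsz g k i)))
   = e *: qform W.
  rewrite -WE scaler_sumr; apply: eq_bigr => i /andP[/negbTE -> /negbTE ->].
  by rewrite -scalerAr.
rewrite cE mul1r linearB linearZ/=.
by ring.
Qed.

End Putinar.

Theorem theorem2 (n : nat) (R : realType)
  (f : {mpoly R[n]}) (g h : seq {mpoly R[n]}) (rad : R) :
  0 < rad ->
  rad%:MP - \sum_(i < n) 'X_i ^+ 2 \in g ->
  (forall k : nat, (kmin f g h <= k)%N ->
     forall c : R, 0 < c -> inQcirc g k c%:MP) /\
  CTP f g h.
Proof.
move=> rad_gt0 ball_g.
have Q_gt0 k c : (kmin f g h <= k)%N -> 0 < c -> inQcirc g k c%:MP.
  exact: inQcirc_gt0 rad_gt0 ball_g.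
split=> [k kk c|k kk]; first exact: Q_gt0.
(* The trace is the value at the constant 1 of a functional with $y_0=1$. *)
exists 1; split; first exact: ltr01.
have [|P [posP trP]] := @constant_trace n R g k; first exact: Q_gt0 ltr01.
by exists P; split=> // y _; apply: trP.
Qed.
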